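(* Let $r,s:\mathbb{N}\to\mathbb{N}$ satisfy $1\le r(i)<s(i)$ for all $i$, and let $b:\mathbb{N}\to\mathbb{N}\cup\{0\}$ satisfy $b(i)\le i$ and $b(i+1)\le b(i)+1$ for all $i$. Assume moreover that $\tilde L(i)>r(i)$ for all but finitely many $i$. Suppose Robin plays the strategy $\mathsf{Oldest}_{RND}$ in the game $RH(r,s,b)$. (1) If $\sum_i r(i)/\tilde L(i)=\infty$, then Robin wins almost surely. (2) If $\sum_i r(i)/\tilde L(i)<\infty$, then the Sheriff wins almost surely.
   Context: The Robin Hood game $RH(r,s,b)$: for each $i\in\mathbb{N}$, on day $i$ the Sheriff puts $s(i)$ new bags (distinctly labelled, no label ever reused) into a cave, and on night $i$ Robin removes $r(i)$ bags from the cave. The function $b$ bounds Robin's historical memory: on night $i$ Robin knows, for each bag put in the cave on days $i-b(i)+1,\dots,i$, on which day it was put in, but he cannot distinguish among the bags put in on days $1,\dots,i-b(i)$; the latter bags still in the cave are called very old (Robin can identify which bags are very old). Strategy $\mathsf{Oldest}_{RND}$: on night $i$, if there are at least $r(i)$ very old bags, Robin removes $r(i)$ of them chosen uniformly at random; otherwise he removes all very old bags and then removes bags from the remembered days in order of their day (oldest day first), taking all bags of an earlier day before any bag of a later day, where the bags taken from the last (partially used) day are chosen uniformly at random, so that $r(i)$ bags in total are removed. Probabilities are over Robin's coin tosses; for a bag $x$, $p_x$ is the probability that $x$ is never removed (the product over nights of the probabilities that $x$ is not removed on that night). Robin wins almost surely if $p_x=0$ for every bag $x$; the Sheriff wins almost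 surely if $\sup_x p_x=1$. Define $\tilde L(i)=\max\{0,\ \sum_{j=1}^{i-b(i)}s(j)-\sum_{j=1}^{i-1}r(j)\}$, the number of bags put in on days $1,\dots,i-b(i)$ and not removed before night $i$. *)

(* Defs.v *)
(* MathComp with MathComp-Analysis. *)
From HB Require Import structures.
From mathcomp Require Export all_boot all_order all_algebra finmap.
From mathcomp Require Export all_classical all_reals all_analysis.

Set Implicit Arguments.
Unset Strict Implicit.
Unset Printing Implicit Defensive.
Import Order.TTheory GRing.Theory Num.Theory.

Local Open Scope classical_set_scope.
Local Open Scope nat_scope.

(* Days and nights are numbered from 1; the values of r, s and b at 0 are
   never used.  The bag (j, k) is the k-th of the s j bags put in on day j. *)
Definition bag : choiceType := (nat * nat)%type.

Definition day (x : bag) : nat := x.1.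

Definition is_bag (s : nat -> nat) (x : bag) : Prop :=
  (0 < day x) && (x.2 < s (day x)).

Definition new_bags (s : nat -> nat) (j : nat) : {fset bag} :=
  [fset ((j, k) : bag) | k in iota 0 (s j)]%fset.

(* A history is the list of the sets removed on nights 1, ..., size h. *)
Definition history := seq {fset bag}.

Definition night (h : history) : nat := (size h).+1.

(* The content of the cave at the beginning of night (night h). *)
Definition cave (s : nat -> nat) (h : history) : {fset bag} :=
  ((\bigcup_(j <- iota 1 (night h)) new_bags s j) `\` \bigcup_(A <- h) A)%fset.

Definition very_old (s b : nat -> nat) (h : history) : {fset bag} :=
  [fset x in cave s h | (day x <= night h - b (night h))%N]%fset.

(* The sets that Oldest_RND may remove.  When there are fewer very old bags
   than needed, any two such sets differ only in which bags they contain of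
   the last, partially used, day: a bag is taken only if all bags of earlier
   days are. *)
Definition oldest_choice (r s b : nat -> nat) (h : history)
    (A : {fset bag}) : bool :=
  let C := cave s h in
  let V := very_old s b h in
  let i := night h in
  [&& (A `<=` C)%fset, #|` A| == r i
    & if r i <= #|` V| then (A `<=` V)%fset
      else (V `<=` A)%fset
           && all (fun x => all (fun y => (day y < day x) ==> (y \in A)) C) A].

Definition oldest_choices (r s b : nat -> nat) (h : history) :
    {fset {fset bag}} :=
  [fset A in fpowerset (cave s h) | oldest_choice r s b h A]%fset.

(* The probability that Oldest_RND removes exactly A after the history h. *)
Definition oldest_rnd (R : realType) (r s b : nat -> nat) (h : history)
    (A : {fset bag}) : R :=
  (if A \in oldest_choices r s b h
   then (#|` oldest_choices r s b h|%:R)^-1 else 0)%R.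

Section Play.
Context {d : measure_display} {T : measurableType d} {R : realType}.
Variable P : probability T R.

(* The random play is given by the sets [removed i] taken out on night i. *)
Variable removed : nat -> T -> {fset bag}.

Definition play (n : nat) (w : T) : history :=
  [seq removed i w | i <- iota 1 n].

(* The conditional law of the removal of each night, given the whole past, is
   the one prescribed by Oldest_RND. *)
Definition plays_oldest_rnd (r s b : nat -> nat) : Prop :=
  (forall (i : nat) (A : {fset bag}), 0 < i ->
     measurable [set w : T | removed i w = A]) /\
  (forall (h : history) (A : {fset bag}),
     P [set w | play (size h).+1 w = rcons h A] =
     (P [set w | play (size h) w = h] * (oldest_rnd R r s b h A)%:E)%E).

Definition p_never_removed (x : bag) : \bar R :=
  P [set w | forall i, 0 < i -> x \notin removed i w].

Definition robin_wins_as (s : nat -> nat) : Prop :=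
  forall x : bag, is_bag s x -> p_never_removed x = 0%E.

Definition sheriff_wins_as (s : nat -> nat) : Prop :=
  ereal_sup [set p_never_removed x | x in [set x : bag | is_bag s x]] = 1%E.

End Play.

(* Truncated subtraction on nat is the max with 0. *)
Definition Ltilde (r s b : nat -> nat) (i : nat) : nat :=
  \sum_(1 <= j < (i - b i).+1) s j - \sum_(1 <= j < i) r j.

(* Here n / 0 = 0; this only concerns the finitely many i with
   Ltilde i <= r i, which are irrelevant to convergence. *)
Definition series_r_Ltilde (R : realType) (r s b : nat -> nat) : \bar R :=
  (\sum_(1 <= i <oo) ((r i)%:R / (Ltilde r s b i)%:R : R)%R%:E)%E.

(* Main.v *)
(* Since the memory window never reaches back to a forgotten day, the number of
   very old bags on night i is always Ltilde i.  So from some night on Robin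
   removes r i of exactly Ltilde i very old bags, each with probability
   a i = r i / Ltilde i.  Every bag eventually becomes very old, and then the
   probability that it survives is multiplied by 1 - a i each night; since
   prod (1 - a i) * (1 + sum a i) <= 1, it tends to 0 if sum a i diverges.  If
   sum a i converges, a bag put in on a late day n is removed with probability
   at most the tail sum of a i over i >= n. *)
Require Import Defs.
From mathcomp Require Import zify ring lra.
Set Implicit Arguments.
Unset Strict Implicit.
Unset Printing Implicit Defensive.
Import Order.TTheory GRing.Theory Num.Theory.
Local Open Scope nat_scope.

(** * Counting the subsets of fixed size of a finite set *)

Definition draws (K : choiceType) (V : {fset K}) (k : nat) : {fset {fset K}} :=
  [fset A in fpowerset V | #|` A| == k]%fset.

Lemma in_draws (K : choiceType) (V A : {fset K}) (k : nat) :
  (A \in draws V k) = (A `<=` V)%fset && (#|` A| == k).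
Proof. by rewrite !inE /= fpowersetE. Qed.

Lemma card_draws_fset (K : choiceType) (V : {fset K}) (k : nat) :
  #|` draws V k| = 'C(#|` V|, k).
Proof.
rewrite (cardfE V) -card_draws.
(* [card_draws] counts subsets of a finite type, so the draws are transported to the subtype of
   elements of [V]. *)
have -> : draws V k =
    [fset [fsetval y in Y : {set V}] | Y in [set Y : {set V} | #|Y| == k]]%fset.
  apply/fsetP => A; rewrite in_draws; apply/idP/imfsetP => /= [|[Y]].
    move=> /andP[AV cA]; exists (fsub V A).
      by rewrite inE card_fsub.
    apply/fsetP => x; apply/idP/imfsetP => /= [xA|[y]].
      by exists [` fsubsetP AV x xA]%fset; rewrite ?in_fsub.
    by rewrite in_fsub => yA ->.
  rewrite inE => cY ->; apply/andP; split.
    by apply/fsubsetP => x /imfsetP[y _ ->]; apply: valP.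
  rewrite card_imfset /=; last exact: val_inj.
  by move: cY; rewrite cardE.
rewrite card_imfset /=; first by rewrite -cardE.
move=> X Y /fsetP eqXY; apply/setP => x.
by have := eqXY (val x); rewrite !inE.
Qed.

(** A uniformly drawn [k]-subset contains a given element with probability [k / #|V|], stated here
    without division. Removing [x] turns the draws containing it into the draws of size [k - 1] from
    the other elements, and then [n * C(n-1, k-1) = k * C(n, k)]. *)
Lemma card_draws_mem (K : choiceType) (V : {fset K}) (k : nat) (x : K) :
  x \in V ->
  #|` [fset A in draws V k | x \in A]%fset| * #|` V| = k * #|` draws V k|.
Proof.
move=> xV; case: k => [|k].
  rewrite mul0n; apply/eqP; rewrite muln_eq0 cardfs_eq0; apply/orP; left.
  apply/eqP/fsetP => A; rewrite !inE /= fpowersetE.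
  by apply/negP => /andP[/andP[_ /eqP/cardfs0_eq ->]]; rewrite inE.
have -> : [fset A in draws V k.+1 | x \in A]%fset =
          [fset (x |` A)%fset | A in draws (V `\ x) k]%fset.
  apply/fsetP => A; apply/idP/imfsetP => /=.
    rewrite !inE /= fpowersetE => /andP[/andP[AV /eqP cA] xA].
    exists (A `\ x)%fset; last by rewrite fsetD1K.
    rewrite in_draws fsetSD //=.
    by move: cA; rewrite (cardfsD1 x) xA add1n => -[->].
  move=> [B]; rewrite in_draws => /andP[BV /eqP cB] ->.
  have xB : x \notin B.
    by apply/negP => /(fsubsetP BV); rewrite !inE eqxx.
  rewrite !inE /= fpowersetE eqxx cardfsU1 xB cB andbT eqxx andbT.
  by rewrite fsubUset fsub1set xV (fsubset_trans BV) ?fsubD1set.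
rewrite card_in_imfset /=; last first.
  move=> B C; rewrite !in_draws => /andP[BV _] /andP[CV _] BC.
  have h D : (D `<=` V `\ x -> (x |` D) `\ x = D)%fset.
    move=> DV; rewrite fsetU1K //.
    by apply/negP => /(fsubsetP DV); rewrite !inE eqxx.
  by rewrite -(h B) // BC h.
rewrite !card_draws_fset.
have -> : #|` V| = #|` (V `\ x)%fset|.+1 by rewrite (cardfsD1 x) xV.
by rewrite mulnC mul_bin_diag.
Qed.

(** * The number of very old bags *)

(** The cutoff day [m] is independent of the length of [h]: the same set is the cave for
    [m = night h] and the very old bags for [m = i - b i], and an induction on [h] can keep [m]
    fixed. *)
Definition bags_left (s : nat -> nat) (h : history) (m : nat) : {fset bag} :=
  ((\bigcup_(j <- iota 1 m) new_bags s j) `\` \bigcup_(A <- h) A)%fset.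

(** Counting is valid only along histories that the strategy can produce; all others turn out to be
    null events in [play_null]. *)
Inductive oldest_history (r s b : nat -> nat) : history -> Prop :=
| oldest_history_nil : oldest_history r s b [::]
| oldest_history_rcons h A : oldest_history r s b h ->
    A \in oldest_choices r s b h -> oldest_history r s b (rcons h A).

Lemma in_new_bags (s : nat -> nat) (j : nat) (x : bag) :
  (x \in new_bags s j) = (day x == j) && (x.2 < s j).
Proof.
apply/imfsetP/andP => /= [[k]|[/eqP <- xs]].
  by rewrite mem_iota add0n => kj -> /=.
by exists x.2; rewrite ?mem_iota //; case: x {xs}.
Qed.

Lemma in_bags_left (s : nat -> nat) (h : history) (m : nat) (x : bag) :
  (x \in bags_left s h m) =
  [&& 0 < day x <= m, x.2 < s (day x) & x \notin (\bigcup_(A <- h) A)%fset].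
Proof.
rewrite /bags_left in_fsetD andbC andbA; congr (_ && _).
apply/bigfcupP/andP => [[j]|[/andP[x0 xm] xs]].
  by rewrite mem_iota add1n ltnS andbT in_new_bags => jm /andP[/eqP -> ->].
by exists (day x); rewrite ?mem_iota ?in_new_bags ?add1n ?ltnS ?x0 ?xm ?eqxx.
Qed.

Lemma in_cave (s : nat -> nat) (h : history) (x : bag) :
  (x \in cave s h) = [&& 0 < day x <= (size h).+1, x.2 < s (day x)
                       & x \notin (\bigcup_(A <- h) A)%fset].
Proof. exact: in_bags_left. Qed.

Lemma in_very_old (s b : nat -> nat) (h : history) (x : bag) :
  (x \in very_old s b h) = (x \in cave s h) && (day x <= night h - b (night h)).
Proof. by rewrite /very_old in_fset. Qed.

Lemma very_oldE (s b : nat -> nat) (h : history) :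
  very_old s b h = bags_left s h (night h - b (night h)).
Proof.
apply/fsetP => x; rewrite in_very_old in_cave in_bags_left.
have := leq_subr (b (night h)) (night h); rewrite /night.
by case: (ltnP 0 (day x)) => //=; case: (_ < s _); case: (_ \notin _);
  rewrite ?andbF //= !andbT; lia.
Qed.

Lemma bags_left_rcons (s : nat -> nat) (h : history) (A : {fset bag}) (m : nat) :
  bags_left s (rcons h A) m = (bags_left s h m `\` A)%fset.
Proof. by rewrite /bags_left -cats1 big_cat big_seq1 fsetDDl. Qed.

Lemma card_new_bags (s : nat -> nat) (j : nat) : #|` new_bags s j| = s j.
Proof.
rewrite /new_bags card_imfset /=; last by move=> k l [].
by rewrite undup_id ?iota_uniq // size_iota.
Qed.

Lemma card_bags_left_nil (s : nat -> nat) (m : nat) :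
  #|` bags_left s [::] m| = \sum_(1 <= j < m.+1) s j.
Proof.
elim: m => [|m IH].
  rewrite big_geq //; apply/eqP; rewrite cardfs_eq0; apply/eqP/fsetP => x.
  by rewrite in_bags_left inE; case: (day x).
rewrite big_nat_recr //= -IH -(card_new_bags s m.+1).
have -> : bags_left s [::] m.+1 = (bags_left s [::] m `|` new_bags s m.+1)%fset.
  apply/fsetP => x; rewrite in_fsetU !in_bags_left big_nil in_new_bags inE /=.
  case: (ltngtP (day x) m.+1) => xm; rewrite ?andbF ?orbF //=.
    by rewrite (xm : day x <= m).
    by rewrite (leqNgt (day x)) (ltnW xm) andbF.
  by rewrite xm ltnn /= andbT.
rewrite cardfsU (_ : (_ `&` _)%fset = fset0) ?cardfs0 ?subn0 //.
apply/fsetP => x; rewrite in_fsetI in_bags_left in_new_bags inE.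
by apply/negP => /andP[/andP[xm _] /andP[/eqP xE _]]; rewrite xE ltnn andbF in xm.
Qed.

Lemma in_oldest_choices (r s b : nat -> nat) (h : history) (A : {fset bag}) :
  (A \in oldest_choices r s b h) = oldest_choice r s b h A.
Proof.
rewrite !inE /= fpowersetE /oldest_choice.
by case: (A `<=` cave s h)%fset.
Qed.

Section MemoryBound.
Variables r s b : nat -> nat.
Hypothesis hbS : forall i, 1 <= i -> b i.+1 <= b i + 1.

Lemma forgotten_mono : {homo (fun i => i - b i) : i j / i <= j}.
Proof.
apply: homo_leq => [//|y x z|[|i]]; first exact: leq_trans.
  (* The growth bound on [b] starts at 1; from 0 to 1 monotonicity holds because the truncated
     [0 - b 0] is 0. *)
  by rewrite sub0n.
by have := hbS (ltn0Sn i); lia.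
Qed.

(* The memory window never reaches back to a day that had been forgotten, so
   each night either removes only bags of days <= m or exhausts these days. *)
Lemma card_bags_left (h : history) (m : nat) :
  oldest_history r s b h -> size h - b (size h) <= m ->
  #|` bags_left s h m| =
  \sum_(1 <= j < m.+1) s j - \sum_(1 <= j < (size h).+1) r j.
Proof.
move=> H; elim: H m => {h} [|h A H IH Ach] m hm.
  by rewrite card_bags_left_nil [X in _ - X]big_geq // subn0.
rewrite size_rcons in hm *.
have {}IH := IH m (leq_trans (forgotten_mono (leqnSn _)) hm).
rewrite bags_left_rcons [X in _ - X]big_nat_recr //= subnDA -IH.
move: Ach; rewrite in_oldest_choices /oldest_choice very_oldE.
case/and3P => AC /eqP cA.
(* By [hm] the days forgotten on this night are all at most [m]. *)
have VB : (bags_left s h (night h - b (night h)) `<=` bags_left s h m)%fset.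
  apply/fsubsetP => x; rewrite !in_bags_left => /andP[/andP[-> xm] ->].
  by rewrite (leq_trans xm).
have sub_case : (A `<=` bags_left s h m)%fset ->
    #|` (bags_left s h m `\` A)%fset| = #|` bags_left s h m| - r (size h).+1.
  by move=> AB; rewrite cardfsDS // cA.
case: ifP => [_ AV|/negbT]; first exact/sub_case/(fsubset_trans AV).
rewrite -ltnNge => cV /andP[VA /allP Aold].
(* Either [A] takes only bags of days up to [m], or it contains some [x] of a later day. In the
   latter case the oldest-first rule forces all bags of days up to [m] into [A], nothing is left,
   and the truncated subtraction is 0 as well. *)
have [/sub_case //|/fsubsetPn[x xA xB]] := boolP (A `<=` bags_left s h m)%fset.
have BA : (bags_left s h m `<=` A)%fset.
  have := fsubsetP AC x xA; rewrite in_cave => /and3P[/andP[x0 xh] xs xnh].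
  have mx : m < day x.
    by move: xB; rewrite in_bags_left x0 xs xnh /= !andbT -ltnNge.
  apply/fsubsetP => y; rewrite in_bags_left => /and3P[/andP[y0 ym] ys ynh].
  have /allP/(_ y) := Aold x xA.
  rewrite in_cave y0 ys ynh (leq_trans ym) ?(leq_trans (ltnW mx)) //.
  by move=> /(_ isT)/implyP; apply; exact: leq_ltn_trans mx.
rewrite (_ : (_ `\` A)%fset = fset0) ?cardfs0; last first.
  by apply/eqP; rewrite fsetD_eq0.
by apply/esym/eqP; rewrite subn_eq0 -[r _]cA fsubset_leq_card.
Qed.

Lemma card_very_old (h : history) : oldest_history r s b h ->
  #|` very_old s b h| = Ltilde r s b (night h).
Proof.
by move=> H; rewrite very_oldE card_bags_left ?forgotten_mono.
Qed.

End MemoryBound.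

Lemma oldest_choices_draws (r s b : nat -> nat) (h : history) :
  r (night h) <= #|` very_old s b h| ->
  oldest_choices r s b h = draws (very_old s b h) (r (night h)).
Proof.
move=> rV; apply/fsetP => A.
rewrite in_oldest_choices in_draws /oldest_choice rV.
case: (boolP (A `<=` very_old s b h)%fset) => AV; rewrite ?andbF //= andbT.
rewrite (fsubset_trans AV) //.
by apply/fsubsetP => x; rewrite in_very_old => /andP[].
Qed.

Lemma card_sep (K : choiceType) (D : {fset K}) (Q : pred K) :
  #|` D| = #|` [fset x in D | Q x]%fset| + #|` [fset x in D | ~~ Q x]%fset|.
Proof.
rewrite -(cardfsID [fset x in D | Q x]%fset D).
congr (_ + _); congr (size (enum_fset _)); apply/fsetP => x.
  by rewrite in_fsetI !in_fset /= !inE; case: (x \in D).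
by rewrite in_fsetD !in_fset /= !inE; case: (x \in D); rewrite ?andbF ?andbT.
Qed.

Local Open Scope classical_set_scope.
Local Open Scope nat_scope.

(** * Comparing measures along the fibres of a map to a countable type *)

Section CountableFibers.
Local Open Scope ereal_scope.
Context {d : measure_display} {T : measurableType d} {R : realType}.
Variables (mu : measure T R) (K : countType) (X : T -> K).
Hypothesis mX : forall h, measurable [set w | X w = h].

Lemma measurable_pred_fibers (Q : set K) : measurable [set w | Q (X w)].
Proof.
rewrite (_ : [set w | Q (X w)] = \bigcup_h [set w | Q h /\ X w = h]).
  apply: countable_bigcupT_measurable; first exact: countableP.
  move=> h; have [Qh|nQh] := pselect (Q h).
    by rewrite (_ : [set w | _] = [set w | X w = h]) //; apply/seteqP; split => w [].
  by rewrite (_ : [set w | _] = set0) //; apply/seteqP; split => w [].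
by apply/seteqP; split => w /= => [Qw|[h _ [Qh ->]] //]; exists (X w).
Qed.

(** Fibres are indexed by their codes under [pickle], so that countable additivity gives a series
    over [nat]. *)
Lemma measure_fibers (E : set T) : measurable E ->
  mu E = \sum_(0 <= n <oo) mu (E `&` [set w | choice.pickle (X w) = n]).
Proof.
move=> mE; rewrite -measure_semi_bigcup.
- congr (mu _); apply/seteqP; split=> [w Ew|w [n _ []] //].
  by exists (choice.pickle (X w)).
- move=> n; apply: measurableI => //.
  exact: (measurable_pred_fibers [set h | choice.pickle h = n]).
- by move=> i j _ _ [w [[_ <-] [_ <-]]].
- rewrite -setI_bigcupr; apply: measurableI => //; apply: bigcupT_measurable => n.
  exact: (measurable_pred_fibers [set h | choice.pickle h = n]).
Qed.

(** With [X] the past of the play, this turns a bound conditional on each history into an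
    unconditional one. *)
Lemma le_measure_fibers (E F : set T) (c : R) :
  (0 <= c)%R -> measurable E -> measurable F ->
  (forall h, mu (E `&` [set w | X w = h]) <=
             c%:E * mu (F `&` [set w | X w = h])) ->
  mu E <= c%:E * mu F.
Proof.
move=> c0 mE mF EF; rewrite (measure_fibers mE) (measure_fibers mF).
rewrite -nneseriesZl //; apply: lee_nneseries => // n _.
(* A number that is not the code of a value of [X] has an empty fibre and contributes 0 to both
   sides. *)
case: (pselect (exists h : K, choice.pickle h = n)) => [[h hn]|hn].
  suff -> : [set w | choice.pickle (X w) = n] = [set w | X w = h] by [].
  apply/seteqP; split => w /= => [wn|-> //].
  by apply: (pcan_inj (@choice.pickleK K)); rewrite wn.
rewrite (_ : [set w | _] = set0) ?setI0 ?measure0 ?mule0 //.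
by apply/seteqP; split => // w /= wn; apply: hn; exists (X w).
Qed.

End CountableFibers.

(** * The law of one night's removal given the past *)

Section Removals.
Context {d : measure_display} {T : measurableType d} {R : realType}.
Variables (P : probability T R) (r s b : nat -> nat).
Variable removed : nat -> T -> {fset bag}.
Hypothesis hplay : plays_oldest_rnd P removed r s b.

(** [bag] is declared as a [choiceType] only; this is the same type of finite sets with the
    countable structure that the fibre lemmas require. *)
Let bag_set : countType := {fset (nat * nat)}.

Lemma size_play (n : nat) (w : T) : size (play removed n w) = n.
Proof. by rewrite size_map size_iota. Qed.

Lemma playS (n : nat) (w : T) :
  play removed n.+1 w = rcons (play removed n w) (removed n.+1 w).
Proof. by rewrite /play -{1}[n.+1]addn1 iotaD map_cat add1n cats1. Qed.

Lemma measurable_removed (i : nat) (Q : set {fset bag}) : 0 < i ->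
  measurable [set w | Q (removed i w)].
Proof.
move=> i0; apply: (@measurable_pred_fibers _ _ bag_set) => h.
exact: hplay.1.
Qed.

Lemma measurable_play_eq (n : nat) (h : history) :
  measurable [set w | play removed n w = h].
Proof.
elim: n h => [|n IH] h.
  have [->|h0] := pselect (h = [::]).
    by rewrite (_ : [set _ | _] = setT) //; apply/seteqP; split.
  by rewrite (_ : [set _ | _] = set0) //; apply/seteqP; split => // w /= /esym.
case: (lastP h) => [|h1 A].
  by rewrite (_ : [set _ | _] = set0) //; apply/seteqP; split.
rewrite (_ : [set _ | _] =
  [set w | play removed n w = h1] `&` [set w | removed n.+1 w = A]).
  by apply: measurableI => //; exact: hplay.1.
apply/seteqP; split => w /=; rewrite playS; first by move/rcons_inj => -[].
by move=> [-> ->].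
Qed.

Lemma measurable_play (n : nat) (Q : set history) :
  measurable [set w | Q (play removed n w)].
Proof.
apply: (@measurable_pred_fibers _ _ (seq bag_set)) => h.
exact: measurable_play_eq.
Qed.

(** A history outside [oldest_history] has a first forbidden removal, whose factor [oldest_rnd] is
    0; later nights only multiply this 0. *)
Lemma play_null (h : history) : ~ oldest_history r s b h ->
  P [set w | play removed (size h) w = h] = 0%E.
Proof.
elim/last_ind: h => [|h A IH] hA; first by case: hA; left.
rewrite size_rcons hplay.2 /oldest_rnd; case: ifP => [Ach|_]; last by rewrite mule0.
by rewrite IH ?mul0e // => hh; apply: hA; right.
Qed.

(** The event is the finite disjoint union, over [A] in [D], of the plays continuing [h] by [A], and
    all of these have the same mass. *)
Lemma measure_play_removed_in (h : history) (D : {fset {fset bag}}) :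
  (D `<=` oldest_choices r s b h)%fset ->
  P [set w | play removed (size h) w = h /\ removed (size h).+1 w \in D] =
  (P [set w | play removed (size h) w = h] *
   (#|` D|%:R / #|` oldest_choices r s b h|%:R)%R%:E)%E.
Proof.
move=> DC.
rewrite (_ : [set _ | _] = \big[setU/set0]_(A <- D)
   [set w | play removed (size h).+1 w = rcons h A]); last first.
  rewrite -bigcup_fset; apply/seteqP; split => w /=.
    by move=> [wh wD]; exists (removed (size h).+1 w); rewrite //= playS wh.
  by move=> [A AD] /=; rewrite playS => /rcons_inj[-> ->].
rewrite measure_fbigsetU; first last.
- by move=> A B _ _ [w /= [->]] /rcons_inj[].
- by move=> A _; exact: measurable_play_eq.
rewrite (eq_big_seq (fun=> (P [set w | play removed (size h) w = h] *
   (#|` oldest_choices r s b h|%:R^-1)%R%:E)%E)); last first.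
  by move=> A AD /=; rewrite hplay.2 /oldest_rnd (fsubsetP DC).
rewrite -[P [set w | play removed (size h) w = h]]fineK ?fin_num_measure //;
  last exact: measurable_play_eq.
under eq_bigr do rewrite -EFinM.
rewrite sumEFin big_const_seq count_predT iter_addr_0 -EFinM; congr _%:E.
by rewrite -[LHS]mulr_natr -mulrA [(_^-1 * _)%R]mulrC.
Qed.

(* The removed set almost surely is one of the prescribed choices, because
   these already carry the whole conditional mass. *)
Lemma measure_play_removed (h : history) (Q : pred {fset bag}) :
  oldest_choices r s b h != fset0 ->
  P [set w | play removed (size h) w = h /\ Q (removed (size h).+1 w)] =
  (P [set w | play removed (size h) w = h] *
   (#|` [fset A in oldest_choices r s b h | Q A]%fset|%:R /
    #|` oldest_choices r s b h|%:R)%R%:E)%E.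
Proof.
move=> C0; set C := oldest_choices r s b h.
set E := [set w | play removed (size h) w = h].
have mE : measurable E by exact: measurable_play_eq.
pose F (Q : pred {fset bag}) := [set w | E w /\ Q (removed (size h).+1 w)].
have mF Q' : measurable (F Q').
  by apply: measurableI => //; exact: (@measurable_removed _ [set A | Q' A]).
(* Only the prescribed choices are counted, so at first this is just a lower bound. *)
have lb Q' : (P E * (#|` [fset A in C | Q' A]%fset|%:R / #|` C|%:R)%R%:E <=
    P (F Q'))%E.
  rewrite -measure_play_removed_in; last exact: fset_sub.
  apply: le_measure; rewrite ?inE //.
    apply: measurableI => //.
    exact: (@measurable_removed _ [set A | A \in [fset A in C | Q' A]%fset]).
  by move=> w /= [Ew wD]; split => //; move: wD; rewrite in_fset => /andP[].
have EF : P E = (P (F Q) + P (F (fun A => ~~ Q A)))%E.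
  rewrite -measureU //.
    congr (P _); apply/seteqP; split=> [w Ew|w [[]|[]] //].
    by case: (boolP (Q (removed (size h).+1 w))); [left|right].
  by apply/seteqP; split=> // w /= [[_ Qw] [_]]; rewrite /= Qw.
have CQ := card_sep C Q.
have c0 : (#|` C|%:R%R : R) != 0%R by rewrite pnatr_eq0 cardfs_eq0.
have := lb (fun A => ~~ Q A); have := lb Q; have := EF.
move: (congr1 (fun n => n%:R%R : R) CQ); rewrite natrD => cR.
rewrite -[P E]fineK ?fin_num_measure // -[P (F Q)]fineK ?fin_num_measure //.
rewrite -[P (F (fun A => ~~ Q A))]fineK ?fin_num_measure //.
rewrite -!EFinM -!EFinD !lee_fin => -[eF] l1 l2; congr (_%:E).
(* The fractions for [Q] and for its negation add up to 1, as the two events add up to [E]; hence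
   both lower bounds are equalities. *)
have := divff c0; rewrite {1}cR mulrDl => c1.
move: (congr1 (fun t => fine (P E) * t)%R c1); rewrite mulr1 mulrDr.
by lra.
Qed.

(** Since [Ltilde] exceeds [r], the removed set is a uniform draw from the very old bags, whose
    number is [Ltilde] for every reachable history; the probability thus depends on [h] only through
    whether [x] is very old. *)
Lemma measure_play_mem (h : history) (x : bag) : let n := size h in
  oldest_history r s b h -> (forall i, 1 <= i -> b i.+1 <= b i + 1) ->
  r n.+1 < Ltilde r s b n.+1 ->
  P [set w | play removed n w = h /\ x \in removed n.+1 w] =
  (P [set w | play removed n w = h] *
   (if x \in very_old s b h
    then (r n.+1)%:R / (Ltilde r s b n.+1)%:R else 0)%R%:E)%E.
Proof.
move=> n H hbS rL; have cV := card_very_old hbS H.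
have Cd := @oldest_choices_draws r s b h; rewrite cV /night -/n in Cd.
have {}Cd := Cd (ltnW rL).
have C0 : 0 < #|` oldest_choices r s b h|.
  by rewrite Cd card_draws_fset bin_gt0 cV ltnW.
rewrite (measure_play_removed (fun A => x \in A)) -?cardfs_gt0 //.
congr (_ * _%:E)%E; case: ifP => xV.
  have /(congr1 (fun n => n%:R%R : R)) := card_draws_mem (r n.+1) xV.
  rewrite -Cd cV !natrM => e.
  have L0 : ((Ltilde r s b n.+1)%:R%R : R) != 0%R by rewrite pnatr_eq0; lia.
  have c0 : (#|` oldest_choices r s b h|%:R : R)%R != 0%R.
    by rewrite pnatr_eq0 -lt0n.
  by apply/eqP; rewrite eqr_div //; apply/eqP.
rewrite (_ : [fset _ in _ | _]%fset = fset0) ?cardfs0 ?mul0r //.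
apply/fsetP => A; rewrite [RHS]inE; apply/negP; rewrite in_fset => /andP[].
by rewrite Cd in_draws => /andP[/fsubsetP AV _] /AV; rewrite xV.
Qed.

End Removals.

(** * Bounds for removal and survival of a single bag *)

Section Survival.
Context {d : measure_display} {T : measurableType d} {R : realType}.
Variables (P : probability T R) (r s b : nat -> nat).
Variable removed : nat -> T -> {fset bag}.
Hypothesis hplay : plays_oldest_rnd P removed r s b.
Hypothesis hbS : forall i, 1 <= i -> b i.+1 <= b i + 1.

Definition taken (h : history) : {fset bag} := (\bigcup_(A <- h) A)%fset.

Lemma taken_rcons (h : history) (A : {fset bag}) :
  taken (rcons h A) = (taken h `|` A)%fset.
Proof. by rewrite /taken -cats1 big_cat big_seq1. Qed.

Lemma mem_taken_play (n : nat) (w : T) (x : bag) :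
  reflect (exists2 i, 0 < i <= n & x \in removed i w)
          (x \in taken (play removed n w)).
Proof.
apply: (iffP (bigfcupP _ _ _ _)) => [[A]|[i i1 xi]].
  by rewrite andbT => /mapP[i]; rewrite mem_iota add1n ltnS => ? ->; exists i.
exists (removed i w) => //; rewrite andbT; apply: map_f.
by rewrite mem_iota add1n ltnS.
Qed.

Lemma day_taken_le (h : history) (x : bag) :
  oldest_history r s b h -> x \in taken h -> day x <= size h.
Proof.
elim=> {h} [|h A _ IH Ach]; first by rewrite /taken big_nil inE.
rewrite taken_rcons size_rcons in_fsetU => /orP[/IH/leqW //|xA].
move: Ach; rewrite in_oldest_choices => /and3P[/fsubsetP/(_ x xA) + _ _].
by rewrite in_cave => /andP[/andP[]].
Qed.

(** Fibres over unreachable histories are null, so the conditional bound is required for reachable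
    ones only. *)
Lemma le_measure_play (n : nat) (E F : set T) (c : R) :
  (0 <= c)%R -> measurable E -> measurable F ->
  (forall h, oldest_history r s b h -> size h = n ->
     (P (E `&` [set w | play removed n w = h]) <=
      c%:E * P (F `&` [set w | play removed n w = h]))%E) ->
  (P E <= c%:E * P F)%E.
Proof.
move=> c0 mE mF EF.
have mX h := measurable_play_eq hplay n h.
apply: (@le_measure_fibers _ _ _ P (seq {fset (nat * nat)}) (play removed n)) => //.
move=> h.
have [P0|[hh hn]] : P [set w | play removed n w = h] = 0%E \/
    oldest_history r s b h /\ size h = n.
- have [hn|hn] := eqVneq (size h) n; last first.
    left; rewrite (_ : [set _ | _] = set0) ?measure0 //.
    by apply/seteqP; split => // w /= wh; rewrite -wh size_play eqxx in hn.
  have [hh|hh] := pselect (oldest_history r s b h); first by right.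
  by left; rewrite -hn; exact: (play_null hplay).
- rewrite (@subset_measure0 _ _ _ P _ [set w | play removed n w = h]) //.
    by rewrite mule_ge0 ?lee_fin.
  exact: measurableI.
- exact: EF.
Qed.

Lemma measurable_mem_removed (n : nat) (x : bag) :
  measurable [set w | x \in removed n.+1 w].
Proof.
exact: (@measurable_removed _ _ _ _ _ _ _ _ hplay n.+1
  [set A : {fset bag} | x \in A]).
Qed.

Lemma measurable_mem_taken (n : nat) (x : bag) :
  measurable [set w | x \in taken (play removed n w)].
Proof.
exact: (@measurable_play _ _ _ _ _ _ _ _ hplay n
  [set h : history | x \in taken h]).
Qed.

Lemma measure_removed_le (n : nat) (x : bag) : r n.+1 < Ltilde r s b n.+1 ->
  (P [set w | x \in removed n.+1 w] <=
   ((r n.+1)%:R / (Ltilde r s b n.+1)%:R : R)%R%:E)%E.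
Proof.
(* The bound is written as a constant times the probability of the whole space, to be compared on
   each history. *)
move=> rL; rewrite -[leRHS]mule1 -(probability_setT P).
apply: (@le_measure_play n) => //.
- exact: measurable_mem_removed.
- move=> h hh hn; rewrite setTI.
  rewrite (_ : _ `&` _ =
      [set w | play removed n w = h /\ x \in removed n.+1 w]); last first.
    by rewrite setIC.
  rewrite -hn (measure_play_mem hplay) // ?hn // muleC.
  apply: lee_wpmul2r => //; rewrite lee_fin.
  by case: ifP => // _; rewrite divr_ge0.
Qed.

Definition surviving (x : bag) (n : nat) : set T :=
  [set w | x \notin taken (play removed n w)].

Lemma measurable_surviving (x : bag) (n : nat) : measurable (surviving x n).
Proof.
exact: (@measurable_play _ _ _ _ _ _ _ _ hplay n
  [set h : history | x \notin taken h]).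
Qed.

Lemma measure_survivingS (x : bag) (n : nat) :
  is_bag s x -> day x <= n.+1 - b n.+1 -> r n.+1 < Ltilde r s b n.+1 ->
  (P (surviving x n.+1) <=
   (1 - (r n.+1)%:R / (Ltilde r s b n.+1)%:R : R)%R%:E * P (surviving x n))%E.
Proof.
move=> /andP[x0 xs] xold rL.
have a1 : ((r n.+1)%:R / (Ltilde r s b n.+1)%:R <= 1 :> R)%R.
  by rewrite ler_pdivrMr ?mul1r ?ler_nat ?ltr0n; lia.
apply: (@le_measure_play n); rewrite ?subr_ge0 //; try exact: measurable_surviving.
move=> h hh hn.
(* If [x] was taken in [h], it does not survive and the left-hand fibre is empty. Otherwise [x] is
   very old, and surviving one more night means avoiding [Y]. *)
have [xh|xh] := boolP (x \in taken h).
  rewrite (_ : _ `&` _ = set0) ?measure0 ?mule_ge0 ?lee_fin ?subr_ge0 //.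
  apply/seteqP; split => // w [/= + wh].
  by rewrite /surviving /= playS wh taken_rcons in_fsetU xh.
set X := [set w | play removed n w = h].
have mX : measurable X by exact: measurable_play_eq hplay n h.
pose Y := [set w | play removed n w = h /\ x \in removed n.+1 w].
have mY : measurable Y.
  by apply: measurableI => //; exact: measurable_mem_removed.
have -> : surviving x n `&` X = X.
  by apply: setIidr => w; rewrite /X /surviving /= => ->.
have -> : surviving x n.+1 `&` X = X `\` Y.
  apply/seteqP; split => w; rewrite /surviving /Y /= playS taken_rcons in_fsetU.
    by rewrite negb_or => -[/andP[_ /negP xr] wh]; split => // -[].
  move=> [wh xr]; split => //; rewrite wh negb_or xh /=.
  by apply/negP => xw; apply: xr.
have YX : Y `<=` X by move=> w [].
have PY : P Y = (P X * ((r n.+1)%:R / (Ltilde r s b n.+1)%:R)%R%:E)%E.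
  have := measure_play_mem hplay x hh hbS; rewrite hn => /(_ rL) ->.
  rewrite ifT // in_very_old in_cave /night hn x0 xs xold xh !andbT.
  by rewrite (leq_trans xold) ?leq_subr.
rewrite (_ : P (X `\` Y) = (P X - P Y)%E); last first.
  by rewrite measureD // ?ltey_eq ?fin_num_measure // (setIidr YX).
rewrite PY.
rewrite -[P X]fineK ?fin_num_measure // -!EFinM -EFinB lee_fin; lra.
Qed.

Lemma measure_taken_young (x : bag) (n : nat) : n < day x ->
  P [set w | x \in taken (play removed n w)] = 0%E.
Proof.
move=> xn; apply/eqP; rewrite -measure_le0 -[leRHS](mul0e (P setT)).
apply: (@le_measure_play n) => //.
- exact: measurable_mem_taken.
move=> h hh hn; rewrite mul0e measure_le0 (_ : _ `&` _ = set0) ?measure0 //.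
apply/seteqP; split => // w /= [+ wh]; rewrite wh => /(day_taken_le hh).
by rewrite hn leqNgt xn.
Qed.

End Survival.

(** * From the series to the winner *)

Section Outcome.
Context {d : measure_display} {T : measurableType d} {R : realType}.
Variables (P : probability T R) (r s b : nat -> nat).
Variable removed : nat -> T -> {fset bag}.
Hypothesis hplay : plays_oldest_rnd P removed r s b.
Hypothesis hrs : forall i, 1 <= i -> 1 <= r i < s i.
Hypothesis hbS : forall i, 1 <= i -> b i.+1 <= b i + 1.

Let a (i : nat) : R := ((r i)%:R / (Ltilde r s b i)%:R)%R.

Let a_ge0 (i : nat) : (0 <= a i)%R. Proof. by rewrite divr_ge0. Qed.

Definition never_removed (x : bag) : set T :=
  [set w | forall i, 0 < i -> x \notin removed i w].

Lemma never_removedE (x : bag) :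
  never_removed x = \bigcap_n surviving removed x n.
Proof.
apply/seteqP; split => w /= => [nr n _|surv i i0].
  by apply/negP => /mem_taken_play[i /andP[i0 _]]; exact/negP/nr.
apply/negP => xi; have /negP := surv i I; apply.
by apply/mem_taken_play; exists i; rewrite ?i0 /=.
Qed.

Lemma measurable_never_removed (x : bag) : measurable (never_removed x).
Proof.
rewrite never_removedE; apply: bigcapT_measurable => n.
exact: (measurable_surviving hplay).
Qed.

(** This makes precise when a bag becomes very old. If day [j] were still remembered, at most [i]
    bags would come from forgotten days; but [r i < Ltilde r s b i] makes their number exceed the
    total removed through night [i], which is at least [i]. *)
Lemma day_forgotten (j i : nat) : 1 <= i -> r i < Ltilde r s b i ->
  \sum_(1 <= k < j.+1) s k <= i -> j <= i - b i.
Proof.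
move=> i1 rL sj; rewrite leqNgt; apply/negP => mj.
have : \sum_(1 <= k < (i - b i).+1) s k <= i.
  apply: leq_trans sj; rewrite [leqRHS](@big_cat_nat _ _ _ (i - b i).+1) //=.
    exact: leq_addr.
  exact: ltnW.
have : i <= \sum_(1 <= k < i.+1) r k.
  rewrite -[leqLHS](subn1 i.+1) -[leqLHS]muln1 -sum_nat_const_nat.
  rewrite big_nat [leqRHS]big_nat.
  by apply: leq_sum => k /andP[/hrs/andP[]].
rewrite big_nat_recr //=; move: rL; rewrite /Ltilde; lia.
Qed.

(* [prod (1 - a i) * (1 + sum a i) <= 1], in an inductive form. *)
Lemma surviving_sum_le1 (x : bag) (m k : nat) :
  is_bag s x ->
  (forall n, m <= n -> day x <= n.+1 - b n.+1 /\ r n.+1 < Ltilde r s b n.+1) ->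
  (fine (P (surviving removed x (m + k))) *
     (1 + \sum_(m.+1 <= i < (m + k).+1) a i) <= 1)%R.
Proof.
move=> xs hm; have fin n : P (surviving removed x n) \is a fin_num.
  by rewrite fin_num_measure //; exact: (measurable_surviving hplay).
elim: k => [|k IH].
  rewrite addn0 big_geq // addr0 mulr1 -lee_fin fineK //.
  by apply: probability_le1; exact: (measurable_surviving hplay).
rewrite addnS big_nat_recr //= ?ltnS ?leq_addr //.
have [xold rL] := hm (m + k) (leq_addr _ _).
have := measure_survivingS hplay hbS xs xold rL.
rewrite -[P (surviving removed x (m + k))]fineK //.
rewrite -[P (surviving removed x (m + k).+1)]fineK // -EFinM lee_fin -/(a _).
set q := fine _ in IH *; set q' := fine _; set S := (\sum_(_ <= i < _) _)%R in IH *.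
have q0 : (0 <= q)%R by rewrite fine_ge0.
have S0 : (0 <= S)%R by apply: sumr_ge0.
have := a_ge0 (m + k).+1; move: (a _) => c c0 qq'.
apply: le_trans IH; apply: (@le_trans _ _ ((1 - c) * q * (1 + (S + c)))%R).
  by apply: ler_wpM2r => //; rewrite !addr_ge0.
(* Expanding [q * (1 + S) - (1 - c) * q * (1 + S + c)] leaves only this nonnegative product. *)
rewrite -subr_ge0 (_ : _ - _ = q * (c * (S + c)))%R; last by ring.
by rewrite !mulr_ge0 ?addr_ge0.
Qed.

Lemma robin_wins : (exists N, forall i, N <= i -> r i < Ltilde r s b i) ->
  series_r_Ltilde R r s b = +oo%E -> robin_wins_as P removed s.
Proof.
move=> [N hL] soo x xs; rewrite /p_never_removed -/(never_removed x).
set p := P _; have pfin : p \is a fin_num.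
  by rewrite fin_num_measure //; exact: measurable_never_removed.
apply/eqP/negP => /negP p0.
have e0 : (0 < fine p)%R by rewrite fine_gt0 // lt0e p0 ltey_eq pfin measure_ge0.
(* Past [N] the inequality [r < Ltilde] holds, and past the sum of [s] the day of [x] is forgotten
   by [day_forgotten]. *)
pose m := N + \sum_(1 <= k < (day x).+1) s k.
have hm n : m <= n -> day x <= n.+1 - b n.+1 /\ r n.+1 < Ltilde r s b n.+1.
  rewrite /m => mn; have rL : r n.+1 < Ltilde r s b n.+1 by apply: hL; lia.
  by split=> //; apply: day_forgotten => //; lia.
(* If [x] survived with probability [p > 0], the partial sums of [a] would be bounded by [1 / p],
   against divergence. *)
have partial k : (\sum_(m.+1 <= i < (m + k).+1) a i <= (fine p)^-1)%R.
  rewrite -[leRHS]mul1r ler_pdivlMr //.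
  apply: le_trans (surviving_sum_le1 k xs hm).
  have S0 : (0 <= \sum_(m.+1 <= i < (m + k).+1) a i)%R by apply: sumr_ge0.
  rewrite mulrC; apply: ler_pM => //; first exact: ltW.
    have mnever := measurable_never_removed x.
    have msurv := measurable_surviving hplay x (m + k).
    apply: fine_le; rewrite ?fin_num_measure // le_measure ?inE //.
    by rewrite never_removedE; exact: bigcap_inf.
  by rewrite lerDr.
have : (series_r_Ltilde R r s b < +oo)%E; last by rewrite soo ltxx.
rewrite /series_r_Ltilde (nneseries_split 1 m); last first.
  by move=> i _; rewrite lee_fin; exact: a_ge0.
rewrite sumEFin lte_add_pinfty ?ltry // add1n.
apply: (@le_lt_trans _ _ ((fine p)^-1)%:E); last by rewrite ltry.
apply: lime_le.
  by apply: is_cvg_nneseries => i _ _; rewrite lee_fin; exact: a_ge0.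
near=> n; rewrite sumEFin lee_fin.
have mn : m.+1 <= n by near: n; exists m.+1.
by have := partial (n - m.+1); rewrite -addSn subnKC.
Unshelve. all: by end_near. Qed.

Lemma sheriff_wins : (exists N, forall i, N <= i -> r i < Ltilde r s b i) ->
  (series_r_Ltilde R r s b < +oo)%E -> sheriff_wins_as P removed s.
Proof.
move=> [N hL] sfin; apply/eqP; rewrite eq_le; apply/andP; split.
  apply: ge_ereal_sup => _ [x _ <-].
  by apply: probability_le1; exact: measurable_never_removed.
apply/lee_addgt0Pr => e e0.
have tail : (\sum_(n <= i <oo) (a i)%:E)%E @[n --> \oo] --> 0%E.
  apply: nneseries_tail_cvg; last by move=> i _; rewrite lee_fin.
  (* The tail lemma sums from 0 while the series starts at 1; the extra term [a 0] is finite. *)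
  rewrite (nneseries_split 0 1); last by move=> i _; rewrite lee_fin.
  by rewrite big_nat1 lte_add_pinfty ?ltry.
have [n [Nn tn]] : exists n, N <= n /\ (\sum_(n.+1 <= i <oo) (a i)%:E <= e%:E)%E.
  have e0' : nbhs (0 : \bar R)%E [set y | (y < e%:E)%E].
    by apply: open_nbhs_nbhs; split; [exact: open_ereal_lt_ereal|].
  have [n0 _ hn0] := tail _ e0'.
  exists (maxn N n0); split; first exact: leq_maxl.
  by apply: ltW; apply: hn0; rewrite /= leqW // leq_maxr.
(* The first bag of day [n.+1], which exists because [s] is positive there; its removals can only
   occur in the tail. *)
pose x : bag := (n.+1, 0).
have xs : is_bag s x by rewrite /is_bag /=; have /andP[_] := hrs (ltn0Sn n); lia.
apply: (@le_trans _ _ (p_never_removed P removed x + e%:E)%E); last first.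
  by apply: leeD2r; apply: ereal_sup_ubound; exists x.
(* The condition [0 < i] makes [F 0] empty, because nothing is assumed about [removed 0]. *)
pose F i := [set w : T | 0 < i /\ x \in removed i w].
have mF i : measurable (F i).
  case: i => [|i]; first by rewrite (_ : F 0 = set0) //; apply/seteqP; split => w [].
  rewrite (_ : F i.+1 = [set w | x \in removed i.+1 w]).
    exact: (measurable_mem_removed hplay).
  by apply/seteqP; split => w [].
pose late := \bigcup_(i in ~` `I_n.+1) F i.
have mlate : measurable late by apply: bigcup_measurable.
have Plate : (P late <= e%:E)%E.
  apply: le_trans tn.
  apply: (@le_trans _ _ (\sum_(n.+1 <= i <oo) P (F i))%E).
    exact: measure_sigma_subadditive_tail.
  rewrite eseries_cond [leRHS]eseries_cond; apply: lee_nneseries => // i ni.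
  case: i ni => // i ni.
  rewrite (_ : F i.+1 = [set w | x \in removed i.+1 w]).
    by apply: (measure_removed_le hplay) => //; apply: hL; lia.
  by apply/seteqP; split => w [].
(* Removals up to night [n] precede the arrival of [x], so they form a null event. *)
pose early := [set w | x \in taken (play removed n w)].
have mearly : measurable early by exact: (measurable_mem_taken hplay).
have Pearly : P early = 0%E by exact: (measure_taken_young hplay).
have mnever := measurable_never_removed x.
rewrite -(probability_setT P).
apply: (@le_trans _ _ (P (never_removed x) + (P early + P late))%E); last first.
  by rewrite Pearly add0e leeD2l.
apply: (@le_trans _ _ (P (never_removed x `|` (early `|` late)))).
  apply: le_measure; rewrite ?inE //; first by do ?apply: measurableU.
  move=> w _.
  have [wn|] := pselect (never_removed x w); first by left.
  move=> /existsNP[i /not_implyP[i0 /negP/negPn xi]]; right.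
  have [ni|ni] := leqP i n.
    by left; apply/mem_taken_play; exists i; rewrite ?i0.
  by right; exists i => //=; apply/negP; rewrite -leqNgt.
apply: (le_trans (measureU2 _ _ _)) => //; first exact: measurableU.
by apply: leeD2l; exact: measureU2.
Qed.

End Outcome.

Theorem theorem2p4 (R : realType) (d : measure_display) (T : measurableType d)
    (P : probability T R) (r s b : nat -> nat)
    (removed : nat -> T -> {fset bag})
    (hrs : forall i, 1 <= i -> 1 <= r i < s i)
    (hb : forall i, 1 <= i -> b i <= i)
    (hbS : forall i, 1 <= i -> b i.+1 <= b i + 1)
    (hL : exists N, forall i, N <= i -> r i < Ltilde r s b i)
    (hplay : plays_oldest_rnd P removed r s b) :
  (series_r_Ltilde R r s b = +oo%E -> robin_wins_as P removed s) /\
  ((series_r_Ltilde R r s b < +oo)%E -> sheriff_wins_as P removed s).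
Proof. by split; [exact: robin_wins | exact: sheriff_wins]. Qed.
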